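(* For $l\ge1$, \[(l+4)f_{A_{l+2}}(t)=(2l+5)(1-2t)f_{A_{l+1}}(t)-(l+1)f_{A_l}(t);\] for $l\ge2$, \[(l+2)f_{B_{l+2}}(t)=(2l+3)(1-2t)f_{B_{l+1}}(t)-(l+1)f_{B_l}(t);\] and for $l\ge4$, \[f_{D_{l+3}}(t)=(a_l+b_lt)f_{D_{l+2}}(t)+(c_l+d_lt+e_lt^2)f_{D_{l+1}}(t)+(f_l+g_lt)f_{D_l}(t),\] where $a_l=\frac{(l+1)(5l^2+4l-21)}{(l-1)(l+3)(5l+4)}$, $b_l=-\frac{2(l+1)(5l^2+4l-21)}{(l-1)(l+3)(5l+4)}$, $c_l=\frac{l(5l^2+14l+5)}{(l-1)(l+3)(5l+4)}$, $d_l=-\frac{4l(2l+1)(5l+9)}{(l-1)(l+3)(5l+4)}$, $e_l=\frac{4l(2l+1)(5l+9)}{(l-1)(l+3)(5l+4)}$, $f_l=-\frac{(l+1)(5l+9)}{(l+3)(5l+4)}$, $g_l=\frac{2(l+1)(5l+9)}{(l+3)(5l+4)}$.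
   Context: Here $f_{A_l}(t)=\sum_{k=0}^l(-1)^k\frac{1}{l+2}\binom{l}{k}\binom{l+k+2}{k+1}t^k$, $f_{B_l}(t)=\sum_{k=0}^l(-1)^k\binom lk\binom{l+k}{k}t^k$, $f_{D_l}(t)=\sum_{k=0}^l(-1)^k\big(\binom lk\binom{l+k-1}{k}+\binom{l-2}{k-2}\binom{l+k-2}{k}\big)t^k$ (with $\binom nm=0$ for $m<0$); these are the $f$-polynomials of the Fomin–Zelevinsky cluster complexes of types $A_l,B_l,D_l$. *)

(* Defs.v *)
From mathcomp Require Import all_boot all_order all_algebra.

Set Implicit Arguments.
Unset Strict Implicit.
Unset Printing Implicit Defensive.

Import GRing.Theory Num.Theory.
Local Open Scope ring_scope.

(* Binomial coefficient with an integer lower index, zero when it is negative;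
   truncated subtraction on [nat] would give 'C(n, 0 - 2) = 1 instead. *)
Definition binz (n : nat) (m : int) : nat :=
  if m is Posz m' then 'C(n, m') else 0%N.

Definition fA (l : nat) : {poly rat} :=
  \sum_(k < l.+1)
    ((-1) ^+ k * (1 / (l + 2)%:R) * 'C(l, k)%:R * 'C(l + k + 2, k + 1)%:R)
      *: 'X^k.

Definition fB (l : nat) : {poly rat} :=
  \sum_(k < l.+1) ((-1) ^+ k * 'C(l, k)%:R * 'C(l + k, k)%:R) *: 'X^k.

(* Meaningful for l >= 2, where the upper indices are not truncated. *)
Definition fD (l : nat) : {poly rat} :=
  \sum_(k < l.+1)
    ((-1) ^+ k *
       ('C(l, k)%:R * 'C(l + k - 1, k)%:R
        + (binz (l - 2) (k%:Z - 2))%:R * 'C(l + k - 2, k)%:R))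
      *: 'X^k.

(* Main.v *)
(* Every coefficient is a rational function of l and k times
   (-1)^k (n + k - c)! / (k!^2 (n - k)!).  All coefficients entering a
   recurrence at a given k are polynomial multiples of one common term
   b! / (k!^2 r!); the multipliers contain falling factorials that vanish
   when the coefficient lies outside the support, so that dividing by the
   common term leaves a single rational identity in l and k that also covers
   the boundary values of k. *)
Require Import Defs.
From mathcomp Require Import all_boot all_order all_algebra.
From mathcomp Require Import zify ring lra.

Set Implicit Arguments.
Unset Strict Implicit.
Unset Printing Implicit Defensive.

Import GRing.Theory Num.Theory.
Local Open Scope ring_scope.

(** The guard is needed because truncated [n - k] would give [0! = 1] beyond the support. The offset
    [c] is 0 for types A and B, and 2 for type D. *)
Definition hyperterm (c n k : nat) : rat :=
  if (k <= n)%N then (n + k - c)`!%:R / (k`!%:R ^+ 2 * (n - k)`!%:R) else 0.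

Definition common_term (b k r : nat) : rat := b`!%:R / (k`!%:R ^+ 2 * r`!%:R).

Lemma fact_neq0 (n : nat) : n`!%:R != 0 :> rat.
Proof. by rewrite pnatr_eq0 -lt0n fact_gt0. Qed.

(* The right-hand side is correct for n < k as well: a factor vanishes. *)
Lemma ffact_prodr (n k : nat) :
  (n ^_ k)%:R = \prod_(i < k) (n%:R - i%:R) :> rat.
Proof.
elim: k => [|k IHk]; first by rewrite big_ord0.
rewrite ffactnSr big_ord_recr /= -IHk natrM.
case: (leqP k n) => [/natrB -> // | ltnk].
by rewrite ffact_small // !mul0r.
Qed.

Lemma fact_split (n k : nat) :
  (k <= n)%N -> n`!%:R = (n ^_ k)%:R * (n - k)`!%:R :> rat.
Proof. by move=> lekn; rewrite -natrM ffact_fact. Qed.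

(** Inside the support, the falling factorials turn [b!], [r!], [k!] into [(b + t)!], [(r - s)!],
    [(k - i)!], the factorials of the term at [k - i]. Outside it, [k ^_ i] vanishes if [k < i] and
    [r ^_ s] vanishes if [n < k - i]. The factor [q] takes a rational argument since [k - i] may be
    negative. *)
Lemma coef_hyperterm_shift (P : {poly rat}) (q : rat -> rat) (c n : nat) :
  (forall k, P`_k = (-1) ^+ k * q k%:R * hyperterm c n k) ->
  forall i t s b r k : nat,
    (n + i + s = r + k)%N -> (b + t + i + c = n + k)%N ->
  (P * 'X^i)`_k =
    (-1) ^+ k * ((-1) ^+ i * q (k%:R - i%:R) * ((b + t) ^_ t)%:R
      * (r ^_ s)%:R * (k ^_ i)%:R ^+ 2) * common_term b k r.
Proof.
move=> coefP_ i t s b r k eq_r eq_b; rewrite coefMXn.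
have [ltki | leik] := ltnP k i.
  by rewrite (ffact_small ltki) expr0n mulr0 mulr0 mul0r.
rewrite coefP_ /hyperterm /common_term; have [lekin | ltnki] := leqP (k - i) n.
  have -> : (n + (k - i) - c = b + t)%N by lia.
  have -> : (n - (k - i) = r - s)%N by lia.
  rewrite (@fact_split (b + t) t) ?leq_addl // addnK.
  rewrite (@fact_split k i) // (@fact_split r s); last by lia.
  have -> : (-1) ^+ k * ((-1) ^+ i * q (k%:R - i%:R) * ((b + t) ^_ t)%:R
      * (r ^_ s)%:R * (k ^_ i)%:R ^+ 2) = (-1) ^+ (k - i) * q (k%:R - i%:R) *
      ((b + t) ^_ t)%:R * (r ^_ s)%:R * (k ^_ i)%:R ^+ 2 :> rat.
    by rewrite -{1}(subnK leik) exprD !mulrA -(mulrA _ _ (_ ^+ i)) -expr2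
      sqrr_sign mulr1.
  rewrite -natrB //; field.
  by rewrite !fact_neq0 !pnatr_eq0 -!lt0n !ffact_gt0 leik; lia.
by rewrite (@ffact_small r s) ?mulr0 ?mul0r ?mulr0 ?mul0r //; lia.
Qed.

(** Settles the indices above the degree of the recurrence, where [r], the degree minus [k], would
    be negative. *)
Lemma coef_hyperterm_small (P : {poly rat}) (q : rat -> rat) (c n : nat) :
  (forall k, P`_k = (-1) ^+ k * q k%:R * hyperterm c n k) ->
  forall i k : nat, (n + i < k)%N -> (P * 'X^i)`_k = 0.
Proof.
move=> coefP_ i k ltk; rewrite coefMXn ltnNge.
rewrite (leq_trans (leq_addl n i)) ?(ltnW ltk) //=.
by rewrite coefP_ /hyperterm leqNgt ltn_subRL addnC ltk mulr0.
Qed.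

Lemma coef_sum_monomials (n : nat) (F : nat -> rat) (k : nat) :
  (\sum_(i < n) F i *: 'X^i)`_k = if (k < n)%N then F k else 0.
Proof. by rewrite -(poly_def n F) coef_poly. Qed.

Lemma binrE (n k : nat) :
  (k <= n)%N -> 'C(n, k)%:R = n`!%:R / (k`!%:R * (n - k)`!%:R) :> rat.
Proof.
by move=> lekn; rewrite -(bin_fact lekn) !natrM mulfK // mulf_neq0 ?fact_neq0.
Qed.

Definition factorA (n : nat) (y : rat) : rat :=
  ((n%:R + y + 1) * (n%:R + y + 2)) / ((y + 1) * (n%:R + 1) * (n%:R + 2)).

Lemma coef_fA (n k : nat) :
  (fA n)`_k = (-1) ^+ k * factorA n k%:R * hyperterm 0 n k.
Proof.
rewrite /factorA /fA (coef_sum_monomials _ (fun k => (-1) ^+ k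
  * (1 / (n + 2)%:R) * 'C(n, k)%:R * 'C(n + k + 2, k + 1)%:R)) ltnS /hyperterm.
case: leqP => [lekn | _]; last by rewrite mulr0.
rewrite !binrE; [|lia|lia].
have -> : (n + k + 2 - (k + 1) = n.+1)%N by lia.
rewrite subn0 !addn2 addn1 !factS !natrM -!natr1 !natrD.
by field; rewrite !fact_neq0 !natr1 -!natrD !pnatr_eq0 !addn2.
Qed.

Definition factorB (y : rat) : rat := 1.

Lemma coef_fB (n k : nat) :
  (fB n)`_k = (-1) ^+ k * factorB k%:R * hyperterm 0 n k.
Proof.
rewrite /factorB /fB (coef_sum_monomials _ (fun k => (-1) ^+ k * 'C(n, k)%:R
  * 'C(n + k, k)%:R)) ltnS /hyperterm.
case: leqP => [lekn | _]; last by rewrite mulr0.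
rewrite !binrE; [|lia|lia].
by rewrite addnK subn0; field; rewrite !fact_neq0.
Qed.

Definition factorD (n : nat) (y : rat) : rat :=
  n%:R * (n%:R + y - 1) + y * (y - 1).

Lemma coef_fD (n : nat) : (2 <= n)%N -> forall k : nat,
  (fD n)`_k = (-1) ^+ k * factorD n k%:R * hyperterm 2 n k.
Proof.
move=> le2n k; rewrite /factorD /fD (coef_sum_monomials _ (fun k => (-1) ^+ k
  * ('C(n, k)%:R * 'C(n + k - 1, k)%:R
     + (binz (n - 2) (k%:Z - 2))%:R * 'C(n + k - 2, k)%:R))) ltnS /hyperterm.
case: leqP => [lekn | _]; last by rewrite mulr0.
rewrite -mulrA; congr (_ * _).
(* The factor [k * (k - 1)] makes the closed form vanish at [k = 0] and [k = 1], exactly where the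
   lower index is negative. *)
have binzE : (binz (n - 2) (k%:Z - 2))%:R
    = k%:R * (k%:R - 1) * (n - 2)`!%:R / (k`!%:R * (n - k)`!%:R) :> rat.
  case: k lekn => [|[|k]] lekn; rewrite ?mul0r ?subrr ?mulr0 ?mul0r //.
  have -> : (k.+2%:Z - 2 = k%:Z)%R by lia.
  rewrite /binz binrE; last by lia.
  have -> : (n - 2 - k = n - k.+2)%N by lia.
  rewrite !factS !natrM -!natr1.
  by field; rewrite !fact_neq0 !natr1 !pnatr_eq0.
rewrite binzE !binrE; [|lia..].
have [m ->] : exists m, n = m.+2 by exists n.-2; lia.
have -> : (m.+2 + k - 1 = (m + k).+1)%N by lia.
have -> : (m.+2 + k - 2 = m + k)%N by lia.
have -> : ((m + k).+1 - k = m.+1)%N by lia.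
rewrite addnK !subSS subn0 !factS !natrM -!natr1 !natrD.
by field; rewrite !fact_neq0 !natr1 !pnatr_eq0.
Qed.

Lemma mulpX0 (P : {poly rat}) : P = P * 'X^0.
Proof. by rewrite expr0 mulr1. Qed.

Lemma mul_linear_poly (P : {poly rat}) :
  (1 - 2 *: 'X) * P = P * 'X^0 - 2 *: (P * 'X^1).
Proof. by rewrite expr0 mulr1 expr1 mulrBl mul1r -scalerAl (mulrC 'X). Qed.

Lemma fA_recurrence (l : nat) :
  (l + 4)%:R *: fA (l + 2) =
    (2 * l + 5)%:R *: ((1 - 2 *: 'X) * fA (l + 1)) - (l + 1)%:R *: fA l.
Proof.
rewrite mul_linear_poly [fA (l + 2)]mulpX0 [fA l]mulpX0.
apply/polyP => k; rewrite !(coefB, coefZ).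
have [ltk | lek] := ltnP (l + 2) k.
  by rewrite !(coef_hyperterm_small (@coef_fA _)) ?(mulr0, subr0) //; lia.
have [r eq_r] : exists r, (l + 2 = r + k)%N by exists (l + 2 - k)%N; lia.
(* Among the four terms, [l + k] is the least numerator argument and [r = l + 2 - k] the greatest
   denominator argument, so all corrections are falling factorials. *)
have shift := coef_hyperterm_shift (@coef_fA _) (b := l + k) (r := r) (k := k).
rewrite (shift (l + 2)%N 0%N 2%N 0%N) ?(shift (l + 1)%N 0%N 1%N 1%N)
  ?(shift (l + 1)%N 1%N 0%N 0%N) ?(shift l 0%N 0%N 2%N); try lia.
have rE : r%:R = l%:R + 2 - k%:R :> rat by rewrite -natrD eq_r natrD addrK.
rewrite /factorA !ffact_prodr !big_ord_recr !big_ord0 /= rE.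
case: k {lek eq_r rE shift} => [|k].
  (* At k = 0 the factor 1 / k of the shifted term is the junk value 0^-1. *)
  rewrite (_ : (1 * (0%:R - 0%:R)) ^+ 2 = 0 :> rat); last first.
    by rewrite subrr mulr0 expr0n.
  rewrite !(mulr0, mul0r).
  by field; rewrite !natr1 -!natrD !pnatr_eq0 !addn2.
rewrite -natr1.
by field; rewrite subrK !natr1 -!natrD !pnatr_eq0 !addn2.
Qed.

(** [fB l] is the Legendre polynomial P_l evaluated at 1 - 2t, and this is Bonnet's recurrence. *)
Lemma fB_recurrence (l : nat) :
  (l + 2)%:R *: fB (l + 2) =
    (2 * l + 3)%:R *: ((1 - 2 *: 'X) * fB (l + 1)) - (l + 1)%:R *: fB l.
Proof.
rewrite mul_linear_poly [fB (l + 2)]mulpX0 [fB l]mulpX0.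
apply/polyP => k; rewrite !(coefB, coefZ).
have [ltk | lek] := ltnP (l + 2) k.
  by rewrite !(coef_hyperterm_small (@coef_fB _)) ?(mulr0, subr0) //; lia.
have [r eq_r] : exists r, (l + 2 = r + k)%N by exists (l + 2 - k)%N; lia.
have shift := coef_hyperterm_shift (@coef_fB _) (b := l + k) (r := r) (k := k).
rewrite (shift (l + 2)%N 0%N 2%N 0%N) ?(shift (l + 1)%N 0%N 1%N 1%N)
  ?(shift (l + 1)%N 1%N 0%N 0%N) ?(shift l 0%N 0%N 2%N); try lia.
have rE : r%:R = l%:R + 2 - k%:R :> rat by rewrite -natrD eq_r natrD addrK.
rewrite /factorB !ffact_prodr !big_ord_recr !big_ord0 /= rE.
ring.
Qed.

Theorem theorem3p1 :
  (forall l : nat, (1 <= l)%N ->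
     (l + 4)%:R *: fA (l + 2) =
       (2 * l + 5)%:R *: ((1 - 2 *: 'X) * fA (l + 1)) - (l + 1)%:R *: fA l)
  /\
  (forall l : nat, (2 <= l)%N ->
     (l + 2)%:R *: fB (l + 2) =
       (2 * l + 3)%:R *: ((1 - 2 *: 'X) * fB (l + 1)) - (l + 1)%:R *: fB l)
  /\
  (forall l : nat, (4 <= l)%N ->
     let x : rat := l%:R in
     let a := ((x + 1) * (5 * x ^+ 2 + 4 * x - 21))
                / ((x - 1) * (x + 3) * (5 * x + 4)) in
     let b := - ((2 * (x + 1) * (5 * x ^+ 2 + 4 * x - 21))
                / ((x - 1) * (x + 3) * (5 * x + 4))) in
     let c := (x * (5 * x ^+ 2 + 14 * x + 5))
                / ((x - 1) * (x + 3) * (5 * x + 4)) in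
     let d := - ((4 * x * (2 * x + 1) * (5 * x + 9))
                / ((x - 1) * (x + 3) * (5 * x + 4))) in
     let e := (4 * x * (2 * x + 1) * (5 * x + 9))
                / ((x - 1) * (x + 3) * (5 * x + 4)) in
     let f := - (((x + 1) * (5 * x + 9)) / ((x + 3) * (5 * x + 4))) in
     let g := (2 * (x + 1) * (5 * x + 9)) / ((x + 3) * (5 * x + 4)) in
     fD (l + 3) =
       (a%:P + b *: 'X) * fD (l + 2)
       + (c%:P + d *: 'X + e *: 'X^2) * fD (l + 1)
       + (f%:P + g *: 'X) * fD l).
Proof.
split=> [l _|]; first exact: fA_recurrence.
split=> [l _|l le4l x a b c d e f g]; first exact: fB_recurrence.
have coef_fD' n k : (l <= n)%N ->
    (fD n)`_k = (-1) ^+ k * factorD n k%:R * hyperterm 2 n k.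
  by move=> leln; apply: coef_fD; lia.
have linE u v n : (u%:P + v *: 'X) * fD n
    = u *: (fD n * 'X^0) + v *: (fD n * 'X^1).
  by rewrite mulrDl mul_polyC -scalerAl (mulrC 'X) expr1 -mulpX0.
have -> : (c%:P + d *: 'X + e *: 'X^2) * fD (l + 1)
    = c *: (fD (l + 1) * 'X^0) + d *: (fD (l + 1) * 'X^1)
      + e *: (fD (l + 1) * 'X^2).
  by rewrite mulrDl -scalerAl (mulrC 'X^2) linE.
rewrite !linE [fD (l + 3)]mulpX0.
apply/polyP => k; rewrite !(coefD, coefZ).
have [ltk | lek] := ltnP (l + 3) k.
  have vanish n i : (l <= n)%N -> (n + i < k)%N -> (fD n * 'X^i)`_k = 0.
    by move=> leln; apply: coef_hyperterm_small => j; apply: coef_fD'.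
  by rewrite !vanish ?(mulr0, addr0) //; lia.
have [r eq_r] : exists r, (l + 3 = r + k)%N by exists (l + 3 - k)%N; lia.
(* The least numerator argument is [l + k - 3], reached by [fD (l + 1) * 'X^2] and [fD l * 'X^1];
   the bound on [l] keeps it nonnegative. *)
have [m eq_m] : exists m, (l + k = m + 3)%N by exists (l + k - 3)%N; lia.
have shift n i t s (leln : (l <= n)%N) :=
  coef_hyperterm_shift (fun j => coef_fD' n j leln) (i := i) (t := t) (s := s)
    (b := m) (r := r) (k := k).
rewrite (shift (l + 3) 0 4 0)%N ?(shift (l + 2) 0 3 1)%N
  ?(shift (l + 2) 1 2 0)%N ?(shift (l + 1) 0 2 2)%N ?(shift (l + 1) 1 1 1)%N
  ?(shift (l + 1) 2 0 0)%N ?(shift l 0 1 3)%N ?(shift l 1 0 2)%N; try lia.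
have rE : r%:R = l%:R + 3 - k%:R :> rat by rewrite -natrD eq_r natrD addrK.
have mE : m%:R = l%:R + k%:R - 3 :> rat by rewrite -natrD eq_m natrD addrK.
rewrite /factorD !ffact_prodr !big_ord_recr !big_ord0 /= !(natrD _ m) rE mE.
rewrite /a /b /c /d /e /f /g /x.
have ge4 : 4 <= l%:R :> rat by rewrite ler_nat.
(* Sign and common term are factors of every summand, so they may be arbitrary. The denominators
   left are [l - 1], [l + 3] and [5 * l + 4], positive for [l >= 4]. *)
move: ((-1) ^+ k) (common_term _ _ _) => z u.
by field; apply/and3P; split; apply: lt0r_neq0; lra.
Qed.
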